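(* Consider problem (P) of the context (no state constraints, free endpoint at infinity), and suppose $\lim_{t\to\infty}\omega(t)=0$. Let $(x_*(\cdot),u_*(\cdot))\in\mathscr{A}_{adm}\cap\mathscr{A}_{Lip}\cap\mathscr{A}_{lim}$ be a strong local minimizer in (P), and let $p(\cdot):\mathbb{R}_+\to\mathbb{R}^n$ be an adjoint function satisfying the maximum principle (M) of the context in normal form, i.e. with $\lambda_0=1$. Then $$\lim_{t\to\infty}H(t,x_*(t),u_*(t),p(t),1)=0.$$
   Context: Notation: $\mathbb{R}_+=[0,\infty)$, $\overline{\mathbb{R}}_+=[0,\infty]$. $W^1_\infty(\mathbb{R}_+,\mathbb{R}^n)$ is the space of bounded, locally absolutely continuous functions with essentially bounded derivative; $L_\infty(\mathbb{R}_+,U)$ is the set of essentially bounded measurable functions with values in $U$. Since $u_*$ is only defined up to null sets, the limit in the claim is understood as an essential limit (i.e. disregarding a null set of $t$). Data: $\omega\in L_1(\mathbb{R}_+,\mathbb{R})$, $\|\omega\|_{L_1}>0$; $f:\mathbb{R}\times\mathbb{R}^n\times\mathbb{R}^m\to\mathbb{R}$, $\varphi:\mathbb{R}\times\mathbb{R}^n\times\mathbb{R}^m\to\mathbb{R}^n$, $h_0:\mathbb{R}^n\to\mathbb{R}^{s_0}$; $\emptyset\ne U\subseteq\mathbb{R}^m$. Problem (P) (free endpoint, i.e. no condition at infinity): minimize $J(x,u)=\int_0^\infty\omega(t)f(t,x(t),u(t))\,dt$ subject to $\dot x(t)=\varphi(t,x(t),u(t))$ (Carathéodory sense), $h_0(x(0))=0$,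 $u(t)\in U$. $\mathscr{A}_{adm}$: all $(x,u)\in W^1_\infty(\mathbb{R}_+,\mathbb{R}^n)\times L_\infty(\mathbb{R}_+,U)$ satisfying all constraints of (P) with $J$ finite. $\mathscr{A}_{Lip}$: all $(x,u)\in W^1_\infty\times L_\infty(\mathbb{R}_+,U)$ such that for every compact $U_1\subset\mathbb{R}^m$ there is $\gamma>0$ such that $f,\varphi,h_0$ are uniformly continuous in all variables and uniformly continuously differentiable in $x$ on $V_\gamma\times U_1$, $V_\gamma=\{(t,y)\in\overline{\mathbb{R}}_+\times\mathbb{R}^n\mid\|y-x(t)\|\le\gamma\}$ (values at $t=\infty$ are limits as $t\to\infty$, whose existence is included). $\mathscr{A}_{lim}$: all $(x,u)\in W^1_\infty\times L_\infty(\mathbb{R}_+,U)$ such that $\int_0^\infty\|\varphi(t,x(t),u(t))\|dt<\infty$, $\int_0^\infty\|\varphi_x(t,x(t),u(t))\|dt<\infty$, and, for some $\gamma>0$: for every $\delta>0$ there is $T>0$ with $\int_T^\infty\|\varphi(t,\xi(t),u(t))-\varphi(t,\xi'(t),u(t))-\varphi_x(t,x(t),u(t))(\xi(t)-\xi'(t))\|dt\le\delta\|\xi-\xi'\|_\infty$ for all $\xi,\xi'\in W^1_\infty(\mathbb{R}_+,\mathbb{R}^n)$ within sup-distance $\gamma$ of $x$. Strong local minimizer: admissible $(x_*,u_* )$ such that for some $\varepsilon>0$, $J(x,u)\ge J(x_*,u_* )$ for all $(x,u)\in\mathscr{A}_{adm}$ with $\|x-x_*\|_\infty\le\varepsilon$.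 Maximum principle (M) in normal form, with $H(t,x,u,p,1)=-\omega(t)f(t,x,u)+\langle p,\varphi(t,x,u)\rangle$: $p$ is locally absolutely continuous; for a.e. $t$, $\dot p(t)=-\varphi_x^T(t,x_*(t),u_*(t))p(t)+\omega(t)f_x(t,x_*(t),u_*(t))$; $p(0)={h_0'}^T(x_*(0))l_0$ for some $l_0\in\mathbb{R}^{s_0}$; $\lim_{t\to\infty}p(t)=0$; and for a.e. $t$, $H(t,x_*(t),u_*(t),p(t),1)=\max_{u\in U}H(t,x_*(t),u,p(t),1)$. *)

(* Defs.v *)
From HB Require Import structures.
From mathcomp Require Import all_boot all_order all_algebra.
From mathcomp Require Import all_classical all_reals all_analysis.

Set Implicit Arguments.
Unset Strict Implicit.
Unset Printing Implicit Defensive.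

Import Order.TTheory GRing.Theory Num.Theory.
Import numFieldNormedType.Exports.

Local Open Scope classical_set_scope.
Local Open Scope ring_scope.

(* Vectors are rows, as in the library's Jacobian ['J], which acts on row
   vectors from the right and hence is the transpose of the usual matrix:
   [v *m 'J F y] is F'(y) v, and [q *m ('J F y)^T] is F'(y)^T q.  The norm on
   vectors and matrices is the library's max norm; the notions below depend on
   the norm only up to equivalence.  Functions on [0, +oo[ are functions on R
   whose values at negative arguments are never constrained or used. *)

(* Measurability, integrability and integrals are those of Lebesgue (not only
   Borel) measurable functions, so that changing a function on a null set never
   matters. *)
Notation Leb R := (@completed_lebesgue_measure R).

(* R with the sigma-algebra of Lebesgue measurable sets *)
Notation LebType R := (caratheodory_type ((@wlength R idfun)^*)%mu).

Definition ae_Rplus {R : realType} (P : R -> Prop) : Prop :=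
  \forall t \ae Leb R, 0 <= (t : R) -> P t.

Section FunctionSpaces.
Context {R : realType} {k : nat}.
Implicit Types x u : R -> 'rV[R]_k.

Definition sup_norm x : \bar R :=
  ereal_sup [set (`|x t|)%:E | t in `[0, +oo[].

Definition abs_continuous (a b : R) x : Prop :=
  forall e : R, 0 < e -> exists2 d : R, 0 < d &
    forall (N : nat) (l r : 'I_N -> R),
      (forall i, a <= l i /\ l i <= r i /\ r i <= b) ->
      trivIset setT (fun i => `]l i, r i[%classic) ->
      \sum_(i < N) (r i - l i) < d ->
      \sum_(i < N) `|x (r i) - x (l i)| < e.

Definition loc_abs_continuous x : Prop :=
  forall b : R, 0 < b -> abs_continuous 0 b x.

Definition W1oo x : Prop :=
  [/\ exists M : R, forall t : R, 0 <= t -> `|x t| <= M,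
      loc_abs_continuous x &
      exists M : R, ae_Rplus (fun t =>
        derivable x t 1 /\ `|'D_1 x t| <= M)].

Definition Loo (U : set 'rV[R]_k) u : Prop :=
  [/\ forall i, measurable_fun (`[0, +oo[ : set (LebType R))
        (fun t => u t 0 i),
      exists M : R, ae_Rplus (fun t => `|u t| <= M) &
      ae_Rplus (fun t => U (u t))].

End FunctionSpaces.

Definition gradient {R : realType} {n : nat} (F : 'rV[R]_n -> R)
    (y : 'rV[R]_n) : 'rV[R]_n :=
  \row_i 'd F y (delta_mx 0 i).

Definition is_max {R : realType} (S : set R) (a : R) : Prop :=
  S a /\ ubound S a.

(* limit at +oo disregarding a null set of arguments *)
Definition ess_lim {R : realType} (g : R -> R) (l : R) : Prop :=
  exists2 N : set R, (Leb R).-negligible N &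
    g t @[t --> within (~` N) +oo] --> l.

Section UniformOnTube.
Context {R : realType} {n m : nat}.

(* Meant for 0 <= t <= +oo: the value at -oo is never used, and the one at +oo
   is meaningful only when the limit exists, which is required separately. *)
Definition ext_infty {T : ptopologicalType} (g : R -> T) (t : \bar R) : T :=
  if t is r%:E then g r else lim (g s @[s --> +oo]).

Definition tube (x : R -> 'rV[R]_n) (gamma : R) : set (\bar R * 'rV[R]_n) :=
  [set ty | (0 <= ty.1)%E /\ `|ty.2 - ext_infty x ty.1| <= gamma].

Definition unif_continuous_on_tube (V : normedModType R)
    (x : R -> 'rV[R]_n) (gamma : R) (U1 : set 'rV[R]_m)
    (g : R -> 'rV[R]_n -> 'rV[R]_m -> V) : Prop :=
  (forall y v, tube x gamma (+oo%E, y) -> U1 v -> cvg (g s y v @[s --> +oo])) /\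
  unif_continuous
    ((fun z => ext_infty (fun s => g s z.1.2 z.2) z.1.1)
      : subspace (tube x gamma `*` U1) -> V).

(* [dg] is to be instantiated with the derivative of [g] in the state. *)
Definition unif_C1_on_tube (V W : normedModType R)
    (x : R -> 'rV[R]_n) (gamma : R) (U1 : set 'rV[R]_m)
    (g : R -> 'rV[R]_n -> 'rV[R]_m -> V)
    (dg : R -> 'rV[R]_n -> 'rV[R]_m -> W) : Prop :=
  [/\ unif_continuous_on_tube x gamma U1 g,
      forall t y v, tube x gamma (t%:E, y) -> U1 v ->
        differentiable (fun y' => g t y' v) y &
      unif_continuous_on_tube x gamma U1 dg].

End UniformOnTube.

Section ControlProblem.
Context {R : realType} {n m s0 : nat}.
Variables (omega : R -> R) (f : R -> 'rV[R]_n -> 'rV[R]_m -> R)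
  (phi : R -> 'rV[R]_n -> 'rV[R]_m -> 'rV[R]_n) (h0 : 'rV[R]_n -> 'rV[R]_s0)
  (U : set 'rV[R]_m).
Implicit Types (x xi p : R -> 'rV[R]_n) (u : R -> 'rV[R]_m).

Definition f_x t y v : 'rV[R]_n := gradient (fun y' => f t y' v) y.

Definition phi_x t y v : 'M[R]_n := 'J (fun y' => phi t y' v) y.

Definition cost x u : \bar R :=
  (\int[Leb R]_(t in `[0%R, +oo[) (omega t * f t (x t) (u t))%:E)%E.

Definition A_adm x u : Prop :=
  [/\ W1oo x, Loo U u,
      ae_Rplus (fun t => is_derive t 1 x (phi t (x t) (u t))),
      h0 (x 0) = 0 &
      (Leb R).-integrable `[0, +oo[
        (fun t => (omega t * f t (x t) (u t))%:E)].

(* The tube includes t = +oo, so the limit of x is required to exist: otherwise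
   [lim] in [ext_infty x +oo] would be a default value. *)
Definition A_Lip x u : Prop :=
  [/\ W1oo x, Loo U u, cvg (x t @[t --> +oo]) &
      forall U1 : set 'rV[R]_m, compact U1 ->
        exists2 gamma : R, 0 < gamma &
        [/\ unif_C1_on_tube x gamma U1 f f_x,
            unif_C1_on_tube x gamma U1 phi phi_x &
            unif_C1_on_tube x gamma U1 (fun _ y _ => h0 y)
              (fun _ y _ => 'J h0 y)]].

Definition lin_error x u xi xi' (t : R) : R :=
  `|phi t (xi t) (u t) - phi t (xi' t) (u t)
    - (xi t - xi' t) *m phi_x t (x t) (u t)|.

Definition A_lim x u : Prop :=
  [/\ W1oo x, Loo U u,
      (Leb R).-integrable `[0, +oo[ (fun t => (`|phi t (x t) (u t)|)%:E),
      (Leb R).-integrable `[0, +oo[ (fun t => (`|phi_x t (x t) (u t)|)%:E) &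
      exists2 gamma : R, 0 < gamma &
        forall delta : R, 0 < delta -> exists2 T : R, 0 < T &
        forall xi xi', W1oo xi -> W1oo xi' ->
          (sup_norm (xi \- x)%R <= gamma%:E)%E ->
          (sup_norm (xi' \- x)%R <= gamma%:E)%E ->
          (Leb R).-integrable `[T, +oo[
            (fun t => (lin_error x u xi xi' t)%:E) /\
          (\int[Leb R]_(t in `[T, +oo[) (lin_error x u xi xi' t)%:E
            <= delta%:E * sup_norm (xi \- xi')%R)%E].

Definition strong_local_minimizer x u : Prop :=
  A_adm x u /\
  exists2 eps : R, 0 < eps &
    forall x' u', A_adm x' u' -> (sup_norm (x' \- x)%R <= eps%:E)%E ->
      (cost x u <= cost x' u')%E.

Definition hamiltonian (t : R) (y : 'rV[R]_n) (v : 'rV[R]_m) (q : 'rV[R]_n)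
    (lambda0 : R) : R :=
  - (lambda0 * (omega t * f t y v)) + \sum_i q 0 i * phi t y v 0 i.

Definition normal_maximum_principle x u p : Prop :=
  [/\ loc_abs_continuous p,
      ae_Rplus (fun t =>
        is_derive t 1 p (- (p t *m (phi_x t (x t) (u t))^T)
          + omega t *: f_x t (x t) (u t))),
      exists l0 : 'rV[R]_s0, p 0 = l0 *m ('J h0 (x 0))^T,
      p t @[t --> +oo] --> (0 : 'rV[R]_n) &
      ae_Rplus (fun t =>
        is_max [set hamiltonian t (x t) v (p t) 1 | v in U]
          (hamiltonian t (x t) (u t) (p t) 1))].

End ControlProblem.

(* Main.v *)
Require Import Defs.
From HB Require Import structures.
From mathcomp Require Import all_boot all_order all_algebra.
From mathcomp Require Import all_classical all_reals all_analysis.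

Set Implicit Arguments.
Unset Strict Implicit.
Unset Printing Implicit Defensive.

Import Order.TTheory GRing.Theory Num.Theory.
Import numFieldNormedType.Exports.

Local Open Scope classical_set_scope.
Local Open Scope ring_scope.

(** Along [(x_, u_)] both [f] and [phi] are essentially bounded for large [t]:
    on the compact ball [U1] containing almost all values of [u_], uniform
    continuity up to [t = +oo] compares [g t (x_ t) v], uniformly in [v], with
    [g +oo (lim x_) v], which is continuous in [v] and hence bounded on [U1].
    As [omega] and [p] tend to 0, so do both terms of the Hamiltonian. *)

(** Entourages of [subspace A] contain the diagonal and the pairs of points of [A] that are close in
    [M]; [or_intror] picks the latter kind, so the modulus [d] concerns the metric of [M] itself. *)
Lemma unif_continuous_subspace_ball (R : realType) (M : pseudoMetricType R)
    (V : normedModType R) (A : set M) (F : M -> V) :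
  unif_continuous (F : subspace A -> V) ->
  forall e : R, 0 < e -> exists2 d : R, 0 < d &
    forall z w, A z -> A w -> ball z d w -> `|F z - F w| < e.
Proof.
move=> Fu e e0.
have /Fu [E Eent sub] := entourage_ball V (PosNum e0).
move: Eent; rewrite -(@entourage_ballE R) => -[d d0 dE].
exists d => // z w Az Aw zdw.
have /= := sub (z, w) (or_intror (conj Az (conj Aw (dE (z, w) zdw)))).
by rewrite -ball_normE.
Qed.

Lemma tube_axis_bounded (R : realType) (n m : nat) (V : normedModType R)
    (x : R -> 'rV[R]_n) (gamma : R) (U1 : set 'rV[R]_m)
    (g : R -> 'rV[R]_n -> 'rV[R]_m -> V) :
  0 < gamma -> cvg (x t @[t --> +oo]) -> compact U1 ->
  unif_continuous_on_tube x gamma U1 g ->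
  exists K : R, \forall t \near +oo, forall v, U1 v -> `|g t (x t) v| <= K.
Proof.
move=> gamma0 cx cU [_ gu].
set xl := lim (x t @[t --> +oo]).
pose G v := ext_infty (fun s => g s xl v) +oo%E.
have gl v : U1 v -> (tube x gamma `*` U1) ((+oo%E, xl), v).
  by move=> Uv; split=> //; split=> //=; rewrite subrr normr0 ltW.
have {}gu := unif_continuous_subspace_ball gu.
(* The two points compared share time [+oo] and state [xl], so their distance is that of the
   controls alone. *)
have cG : {within U1, continuous G}.
  apply/subspace_continuousP => v Uv.
  apply/cvgrPdist_lt => e /gu[d d0 H].
  rewrite near_withinE; near=> w => Uw.
  apply: (H ((+oo%E, xl), v) ((+oo%E, xl), w)); [exact: gl|exact: gl|].
  by split; [split; exact: ballxx|near: w; exact: nbhsx_ballx].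
(* Boundedness makes every number strictly above [M] a bound, whence [M + 1]. *)
have [M [_ GM]] := compact_bounded (continuous_compact cG cU).
have {}GM v : U1 v -> `|G v| <= M + 1.
  by move=> Uv; apply: (GM (M + 1)); [rewrite ltrDl|exists v].
(* Passing from [+oo] to a finite [t] costs at most 1, the second 1 in the final bound; [d] does not
   depend on [v]. *)
have [d d0 H] := gu 1 ltr01.
exists (M + 1 + 1); near=> t => v Uv.
rewrite -lerBlDr (le_trans _ (GM v Uv))// lerBlDr.
rewrite -lerBlDl (le_trans (lerB_dist _ _))// distrC ltW//.
apply: (H ((+oo%E, xl), v) ((t%:E, x t), v)); first exact: gl.
  split=> //; split=> /=; last by rewrite subrr normr0 ltW.
  by rewrite lee_fin; near: t; exact: nbhs_pinfty_ge.
split; last exact: ballxx.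
split=> /=; near: t.
  (* In the metric of the extended reals every ball around [+oo] contains all large finite times. *)
  have : t%:E @[t --> +oo%R] --> (+oo%E : \bar R) by apply/cvgeryP.
  by move=> /(_ _ (nbhsx_ballx (+oo%E : \bar R) d d0)).
exact: (cx _ (nbhsx_ballx xl d d0)).
Unshelve. all: by end_near. Qed.

(** The filter is arbitrary so that it can be [+oo] restricted to the complement of a null set. *)
Lemma cvg0_mul_bounded (R : realType) (T : Type) (F : set_system T)
    (FF : Filter F) (a b : T -> R) (K : R) :
  a @ F --> 0 -> (\forall t \near F, `|b t| <= K) ->
  a t * b t @[t --> F] --> 0.
Proof.
move=> a0 bK; apply/norm_cvg0P.
apply: (@squeeze_cvgr _ _ _ _ (cst 0) (fun t => `|a t| * K)).
- by near=> t; rewrite normr_ge0 normrM ler_wpM2l//; near: t.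
- exact: cvg_cst.
- rewrite -[X in _ --> X](mul0r K); apply: cvgMl.
  by rewrite -(normr0 R); apply: cvg_norm.
Unshelve. all: by end_near. Qed.

Lemma norm_row_entry (R : realType) (n : nat) (y : 'rV[R]_n) (i : 'I_n) :
  `|y 0 i| <= `|y|.
Proof.
rewrite [leRHS]/Num.norm /= mx_normrE.
exact: (le_bigmax _ (fun ij : 'I_1 * 'I_n => `|y ij.1 ij.2|) (0, i)).
Qed.

Theorem lemma4p5 (R : realType) (n m s0 : nat)
  (omega : R -> R) (f : R -> 'rV[R]_n -> 'rV[R]_m -> R)
  (phi : R -> 'rV[R]_n -> 'rV[R]_m -> 'rV[R]_n)
  (h0 : 'rV[R]_n -> 'rV[R]_s0) (U : set 'rV[R]_m)
  (omega_L1 : (Leb R).-integrable `[0, +oo[ (fun t => (omega t)%:E))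
  (omega_norm_gt0 : (0 < \int[Leb R]_(t in `[0%R, +oo[) (`|omega t|)%:E)%E)
  (U_neq0 : U !=set0)
  (omega_cvg0 : omega t @[t --> +oo] --> (0 : R))
  (x_ : R -> 'rV[R]_n) (u_ : R -> 'rV[R]_m) (p : R -> 'rV[R]_n)
  (adm : A_adm omega f phi h0 U x_ u_)
  (lip : A_Lip f phi h0 U x_ u_)
  (alim : A_lim phi U x_ u_)
  (min : strong_local_minimizer omega f phi h0 U x_ u_)
  (pmp : normal_maximum_principle omega f phi h0 U x_ u_ p) :
  ess_lim (fun t => hamiltonian omega f phi t (x_ t) (u_ t) (p t) 1) 0.
Proof.
case: lip => _ [_ [M uM] _] cx /(_ [set v | `|v| <= M]) tubeP.
case: pmp => _ _ _ p0 _.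
have compactU1 : compact [set v : 'rV[R]_m | `|v| <= M].
  apply: bounded_closed_compact.
    by exists M; rewrite num_real; split=> // N MN v /= /le_trans; apply; exact: ltW.
  have -> : [set v : 'rV[R]_m | `|v| <= M] = closed_ball_ Num.norm 0 M.
    by apply/seteqP; split=> v; rewrite /closed_ball_ /= sub0r normrN.
  exact: closed_closed_ball_.
have {tubeP} [gamma gamma0 [[uf _ _] [uphi _ _] _]] := tubeP compactU1.
have [Kf fK] := tube_axis_bounded gamma0 cx compactU1 uf.
have [Kphi phiK] := tube_axis_bounded gamma0 cx compactU1 uphi.
(* This is the exceptional set in [uM]; off it the bound on [u_] holds for [0 <= t], hence
   eventually. *)
set N := ~` [set t : R | 0 <= t -> `|u_ t| <= M].
exists N; first exact: uM.
have bounded (V : normedModType R) (g : R -> 'rV[R]_n -> 'rV[R]_m -> V) K :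
    (\forall t \near +oo, forall v, `|v| <= M -> `|g t (x_ t) v| <= K) ->
    \forall t \near within (~` N) +oo, `|g t (x_ t) (u_ t)| <= K.
  move=> gK; rewrite near_withinE; near=> t => /contrapT tU.
  have : `|u_ t| <= M by apply: tU; near: t; exact: nbhs_pinfty_ge.
  (* The bound is uniform in [v], so [u_ t] may replace [v] without any continuity of [u_]. *)
  by move: (u_ t); near: t.
have {}fK := bounded _ _ _ fK; have {}phiK := bounded _ _ _ phiK.
have omega0 : omega t @[t --> within (~` N) +oo] --> 0.
  exact: cvg_within_filter.
rewrite /hamiltonian -[X in _ --> X]addr0; apply: cvgD.
  rewrite -oppr0; apply: cvgN; under eq_fun do rewrite mul1r.
  exact: cvg0_mul_bounded fK.
(* The limit is taken in each of the [n] terms of the pairing separately. *)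
rewrite [X in _ --> X](_ : 0 = \sum_(i < n) (0 : R)); last by rewrite big1.
apply: (cvg_big add_continuous) => i _.
apply: (@cvg0_mul_bounded _ _ _ _ _ _ Kphi).
  apply: cvg_within_filter.
  have := cvg_comp _ _ p0 (@coord_continuous R 1 n 0 i 0).
  by rewrite mxE.
by near=> t; rewrite (le_trans (norm_row_entry _ _))//; near: t.
Unshelve. all: by end_near. Qed.
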